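(* A weakly o-minimal pair $\mathbf p=(p,<)$ over $A$ has simple semiintervals if and only if every relatively $A$-definable subset of $p(\mathfrak C)^2$ is relatively defined by some finite Boolean combination of $x\leqslant y$, $y\leqslant x$ and formulae of the form $E(x,y)$ for $E\in\mathcal E_p$.
   Context: $T$ is an arbitrary (possibly multi-sorted) complete first-order theory with monster model $\mathfrak C$; $A$ is a small parameter set. For a complete type $p\in S(A)$, $p(\mathfrak C)$ is its set of realizations; a set $X\subseteq p(\mathfrak C)^n$ is relatively $B$-definable if $X=\phi(\mathfrak C)\cap p(\mathfrak C)^n$ for some $L_B$-formula $\phi$ (which then relatively defines $X$), and relatively definable if it is so for some $B$. A weakly o-minimal pair over $A$ is $\mathbf p=(p,<)$ where $p\in S(A)$, $<$ is a relatively $A$-definable linear order on $p(\mathfrak C)$ (relatively defined by a formula written $x<y$), and every relatively definable subset of $p(\mathfrak C)$ is a finite union of $<$-convex subsets of $p(\mathfrak C)$. $\mathcal E_p$ is the set of all relatively $A$-definable equivalence relations on $p(\mathfrak C)$; for $E\in\mathcal E_p$, $E(x,y)$ also denotes an $L_A$-formula that relatively defines $E$. A $\mathbf p$-semiinterval is a convex subset $S$ of $(p(\mathfrak C),<)$ such that $a=\min S$ exists and $S$ is relatively $Aa$-definable within $p(\mathfrak C)$. It is $\mathcal E_p$-determined if $S=\{x\in[a]_E\mid a\leqslant x\}$ for some $E\in\mathcal E_p$. The pair $\mathbf p$ has simple semiintervals if every $\mathbf p$-semiinterval is $\mathcal E_p$-determined. *)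

(* Defs.v *)
From mathcomp Require Import all_boot.
From mathcomp Require Import boolp classical_sets functions cardinality.

Set Implicit Arguments.
Unset Strict Implicit.
Unset Printing Implicit Defensive.

Local Open Scope classical_set_scope.
Local Open Scope card_scope.

Record language := Language {
  lsort : Type;
  lfunc : Type;
  farity : lfunc -> nat;
  fdom : forall f : lfunc, 'I_(farity f) -> lsort;
  fcod : lfunc -> lsort;
  lrel : Type;
  rarity : lrel -> nat;
  rdom : forall r : lrel, 'I_(rarity r) -> lsort }.

Section Syntax.
Variable L : language.

(* A context is a type V of free variables with their sorts, sg : V -> lsort L.
   V may be infinite; a formula mentions only finitely many of its elements. *)
Inductive term (V : Type) (sg : V -> lsort L) : lsort L -> Type :=
| Tvar (v : V) : term sg (sg v)
| Tapp (f : lfunc L) (t : forall i, term sg (fdom (f := f) i)) :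
    term sg (fcod f).

Definition ctx_cons (V : Type) (sg : V -> lsort L) (s : lsort L)
    (v : option V) : lsort L :=
  if v is Some v then sg v else s.

Inductive formula (V : Type) (sg : V -> lsort L) : Type :=
| Ffalse
| Feq (s : lsort L) (t u : term sg s)
| Frel (r : lrel L) (t : forall i, term sg (rdom (r := r) i))
| Fnot (phi : formula sg)
| Fand (phi psi : formula sg)
| Fex (s : lsort L) (phi : formula (ctx_cons sg s)).

Definition sentence := formula (of_void (lsort L)).

Inductive boolean_combination (V : Type) (sg : V -> lsort L)
    (G : set (formula sg)) : formula sg -> Prop :=
| BCgen phi : G phi -> boolean_combination G phi
| BCnot phi : boolean_combination G phi -> boolean_combination G (Fnot phi)
| BCand phi psi : boolean_combination G phi -> boolean_combination G psi ->
    boolean_combination G (Fand phi psi).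

End Syntax.

Record structure (L : language) := Structure {
  carrier :> lsort L -> Type;
  carrier_inhabited : forall s, inhabited (carrier s);
  fint : forall f : lfunc L,
    (forall i, carrier (fdom (f := f) i)) -> carrier (fcod f);
  rint : forall r : lrel L,
    (forall i, carrier (rdom (r := r) i)) -> Prop }.

Section Semantics.
Variables (L : language) (M : structure L).

(* Tuples of elements of M of the sorts prescribed by sg, i.e. assignments. *)
Definition tup (V : Type) (sg : V -> lsort L) : Type := forall v, M (sg v).

Definition tup_cons (V : Type) (sg : V -> lsort L) (s : lsort L) (a : tup sg)
    (c : M s) : tup (ctx_cons sg s) :=
  fun v => match v with Some v => a v | None => c end.

Fixpoint eval (V : Type) (sg : V -> lsort L) (a : tup sg) (s : lsort L)
    (t : term sg s) : M s :=
  match t with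
  | Tvar v => a v
  | Tapp f t => fint (fun i => eval a (t i))
  end.

Fixpoint sat (V : Type) (sg : V -> lsort L) (phi : formula sg) :
    tup sg -> Prop :=
  match phi with
  | Ffalse => fun=> False
  | Feq s t u => fun a => eval a t = eval a u
  | Frel r t => fun a => rint (fun i => eval a (t i))
  | Fnot phi => fun a => ~ sat phi a
  | Fand phi psi => fun a => sat phi a /\ sat psi a
  | Fex s phi => fun a => exists c : M s, sat phi (tup_cons a c)
  end.

Definition tup_nil : tup (of_void (lsort L)) :=
  fun v => match v with end.

Definition same_type (V : Type) (sg : V -> lsort L) (a b : tup sg) : Prop :=
  forall phi : formula sg, sat phi a <-> sat phi b.

Record is_automorphism (g : forall s, M s -> M s) : Prop := {
  aut_bij : forall s, bijective (g s);
  aut_func : forall (f : lfunc L) (a : tup (fdom (f := f))),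
    g _ (fint a) = fint (fun i => g _ (a i));
  aut_rel : forall (r : lrel L) (a : tup (rdom (r := r))),
    rint a <-> rint (fun i => g _ (a i)) }.

Definition elt : Type := {s : lsort L & M s}.

Definition entries (V : Type) (sg : V -> lsort L) (a : tup sg) : set elt :=
  range (fun v => existT (fun s => M s) (sg v) (a v)).

(* The L_B-formulas in the context sg are the L-formulas in sg enlarged by one
   variable for each element of B, to be evaluated at that element. *)
Definition ctx_over (B : set elt) (V : Type) (sg : V -> lsort L)
    (v : V + {e : elt | B e}) : lsort L :=
  match v with inl v => sg v | inr b => projT1 (proj1_sig b) end.

Definition formula_over (B : set elt) (V : Type) (sg : V -> lsort L) : Type :=
  formula (@ctx_over B V sg).

Definition tup_over (B : set elt) (V : Type) (sg : V -> lsort L) (a : tup sg) :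
    tup (@ctx_over B V sg) :=
  fun v => match v with inl v => a v | inr b => projT2 (proj1_sig b) end.

Definition sat_over (B : set elt) (V : Type) (sg : V -> lsort L)
    (phi : formula_over B sg) (a : tup sg) : Prop :=
  sat phi (tup_over a).

Definition realizations (B : set elt) (V : Type) (sg : V -> lsort L)
    (p : set (formula_over B sg)) : set (tup sg) :=
  [set a | forall phi, p phi -> sat_over phi a].

Definition finitely_satisfiable (B : set elt) (V : Type) (sg : V -> lsort L)
    (p : set (formula_over B sg)) : Prop :=
  forall q, finite_set q -> q `<=` p -> realizations q !=set0.

Definition complete_type (B : set elt) (V : Type) (sg : V -> lsort L)
    (p : set (formula_over B sg)) : Prop :=
  finitely_satisfiable p /\ forall phi, p phi \/ p (Fnot phi).

End Semantics.

Definition theory (L : language) : Type := set (sentence L).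

Definition models (L : language) (M : structure L) (T : theory L) : Prop :=
  forall phi, T phi -> sat phi (@tup_nil L M).

Definition entails (L : language) (T : theory L) (phi : sentence L) : Prop :=
  forall M : structure L, models M T -> sat phi (@tup_nil L M).

Definition complete_theory (L : language) (T : theory L) : Prop :=
  (exists M : structure L, models M T) /\
  forall phi, entails T phi \/ entails T (Fnot phi).

(* The cardinal kappa is given by a type K of that cardinality. *)
Definition small (K U : Type) (B : set U) : Prop := ~~ ([set: K] #<= B).

Definition saturated (L : language) (M : structure L) (K : Type) : Prop :=
  forall (B : set (elt M)) (n : nat) (sg : 'I_n -> lsort L)
    (q : set (formula_over B sg)),
  small K B -> finitely_satisfiable q -> realizations q !=set0.

(* a and b enumerate the graph of a partial elementary map. *)
Definition strongly_homogeneous (L : language) (M : structure L) (K : Type) :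
    Prop :=
  forall (I : Type) (sg : I -> lsort L) (a b : tup M sg),
  small K [set: I] -> same_type a b ->
  exists2 g : (forall s, M s -> M s),
    is_automorphism g & forall i, g _ (a i) = b i.

(* The first clause says that |L| + aleph_0 < kappa. *)
Definition monster_model (L : language) (T : theory L) (M : structure L)
    (K : Type) : Prop :=
  [/\ small K [set: nat + (lsort L + (lfunc L + lrel L))], models M T,
      saturated M K & strongly_homogeneous M K].

Section Pairs.
Variables (L : language) (M : structure L) (A : set (elt M)).
Variables (k : nat) (sg : 'I_k -> lsort L) (p : set (formula_over A sg)).
Local Notation tuple := (tup M sg).
Local Notation pC := (realizations p).

(* The context of n k-tuples of variables. *)
Definition ctx_power (n : nat) (v : 'I_n * 'I_k) : lsort L := sg v.2.

Definition tup_power (n : nat) (x : 'I_n -> tuple) : tup M (@ctx_power n) :=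
  fun v => x v.1 v.2.

Definition relatively_defines (B : set (elt M)) (n : nat)
    (phi : formula_over B (@ctx_power n)) (X : set ('I_n -> tuple)) : Prop :=
  X = [set x | sat_over phi (tup_power x)] `&` [set x | forall i, pC (x i)].

Definition relatively_definable_over (B : set (elt M)) (n : nat)
    (X : set ('I_n -> tuple)) : Prop :=
  exists phi : formula_over B (@ctx_power n), relatively_defines phi X.

Definition relatively_definable (n : nat) (X : set ('I_n -> tuple)) : Prop :=
  exists B, relatively_definable_over B X.

(* Subsets of p(C) as subsets of p(C)^1, relations as subsets of p(C)^2. *)
Definition set_power1 (X : set tuple) : set ('I_1 -> tuple) :=
  [set x | X (x ord0)].

Definition set_power2 (R : tuple -> tuple -> Prop) : set ('I_2 -> tuple) :=
  [set x | R (x ord0) (x ord_max)].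

Variable lt : tuple -> tuple -> Prop.

Definition le (x y : tuple) : Prop :=
  [/\ pC x, pC y & lt x y \/ x = y].

Definition linear_order : Prop :=
  [/\ forall x, pC x -> ~ lt x x,
      forall x y z, pC x -> pC y -> pC z -> lt x y -> lt y z -> lt x z &
      forall x y, pC x -> pC y -> [\/ lt x y, x = y | lt y x]].

Definition convex (X : set tuple) : Prop :=
  X `<=` pC /\
  forall x y z, X x -> X z -> pC y -> lt x y -> lt y z -> X y.

Definition finite_union_of_convex (X : set tuple) : Prop :=
  exists (m : nat) (F : 'I_m -> set tuple),
    (forall i, convex (F i)) /\ X = \bigcup_i F i.

Definition weakly_o_minimal_pair : Prop :=
  [/\ complete_type p,
      relatively_definable_over A (set_power2 lt),
      linear_order &
      forall X : set tuple,
        relatively_definable (set_power1 X) -> finite_union_of_convex X].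

Definition equivalence_on (E : tuple -> tuple -> Prop) : Prop :=
  [/\ forall x, pC x -> E x x,
      forall x y, pC x -> pC y -> E x y -> E y x &
      forall x y z, pC x -> pC y -> pC z -> E x y -> E y z -> E x z].

(* The set written E_p in the literature. *)
Definition definable_equivalences : set (tuple -> tuple -> Prop) :=
  [set E | equivalence_on E /\ relatively_definable_over A (set_power2 E)].

Definition is_min (S : set tuple) (a : tuple) : Prop :=
  S a /\ forall x, S x -> le a x.

Definition semiinterval (S : set tuple) (a : tuple) : Prop :=
  [/\ convex S, is_min S a &
      relatively_definable_over (A `|` entries a) (set_power1 S)].

Definition equivalence_determined (S : set tuple) (a : tuple) : Prop :=
  exists2 E, definable_equivalences E & S = [set x | E a x /\ le a x].

Definition simple_semiintervals : Prop :=
  forall (S : set tuple) (a : tuple),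
    semiinterval S a -> equivalence_determined S a.

(* The formulae denoted by x <= y, y <= x and E(x,y) for E in E_p. *)
Definition order_equivalence_formulas :
    set (formula_over A (@ctx_power 2)) :=
  [set phi | [\/ relatively_defines phi (set_power2 le),
                 relatively_defines phi (set_power2 (fun x y => le y x)) |
                 exists2 E, definable_equivalences E &
                   relatively_defines phi (set_power2 E)]].

End Pairs.

(* Main.v *)
(* In a weakly o-minimal pair, no monotone sequence enters and leaves a
   relatively definable set D infinitely often. Hence, if g is an automorphism
   preserving D and b < c < g b with b in D, then c is in D: otherwise iterate
   g. The same argument shows that the classes of E in E_p are convex. For D
   relatively definable over Aa and b > a in D, it also shows that the set of
   x >= a not lying beyond the convex component of b in D is invariant under
   automorphisms fixing Aa; being relatively definable with extra parameters, it
   is a semiinterval, by compactness.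

   If semiintervals are simple, a definable set separating b and c above a thus
   gives E in E_p separating them, so pairs agreeing on <= and on all E in E_p
   agree on every A-definable relation, and compactness gives a finite Boolean
   combination. Conversely, a Boolean combination is constant at points above a
   lying in the same classes of finitely many E_i; the sets {x in [a]_(E_i) |
   a <= x} being initial segments of [a, oo), so is a semiinterval, and it must
   be one of them, {a}, or everything. *)

Require Import Defs.
From mathcomp Require Import all_boot.
From mathcomp Require Import boolp classical_sets functions cardinality.

Set Implicit Arguments.
Unset Strict Implicit.
Unset Printing Implicit Defensive.

Local Open Scope classical_set_scope.

(** * Small sets *)

Lemma not_smallP (K U : Type) (B : set U) :
  ~ small K B <-> exists2 f : K -> U, injective f & forall x, B (f x).
Proof.
rewrite /small; split.
  move=> /negP; rewrite negbK => /card_leP[f].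
  have Kin (x : K) : x \in [set: K] by rewrite inE.
  exists (fun x => set_val (f (SigSub (Kin x)))) => [x y /val_inj|x].
    by move=> /(@inj _ _ _ f) -/(_ _ _)/[!inE]-/(_ I I) [].
  exact: set_valP.
move=> [f fI fB]; apply/negP; rewrite negbK.
have : $|{injfun [set: K] >-> B}|.
  by apply/injfunPex; exists f => // x y _ _; exact: fI.
by case=> g; exact: inj_card_le.
Qed.

(** Hilbert's hotel: [tau] shifts along the sequence [j] and so misses [j 0]; the transposition [t]
    then moves the missed point to [x0]. *)
Lemma infinite_type_avoid (K : Type) (j : nat -> K) (x0 : K) :
  injective j -> exists2 s : K -> K, injective s & forall x, s x <> x0.
Proof.
move=> jI.
have [t tI t0] : exists2 t : K -> K, injective t & t (j 0) = x0.
  exists (fun x => if `[< x = j 0 >] then x0 else if `[< x = x0 >] then j 0 else x).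
    by move=> x y; do !case: asboolP; congruence.
  by case: asboolP.
have tauP x : exists y, (forall n, x = j n -> y = j n.+1) /\
                        ((forall n, x <> j n) -> y = x).
  have [[n ->]|nj] := pselect (exists n, x = j n).
    by exists (j n.+1); split=> [m /jI -> //|/(_ n)].
  by exists x; split=> // n xn; case: nj; exists n.
have [tau tauE] := choice tauP.
have tauj n : tau (j n) = j n.+1 by have [/(_ n)->] := tauE (j n).
have tauN x : ~ (exists n, x = j n) -> tau x = x.
  by move=> nx; have [_ ->] := tauE x => // n xn; apply: nx; exists n.
exists (t \o tau).
  move=> x y /= /tI.
  have [[n ->]|nx] := pselect (exists n, x = j n);
    have [[m ->]|ny] := pselect (exists n, y = j n); rewrite ?tauj ?tauN //.
  - by move=> /jI [->].
  - by move=> yE; case: ny; exists n.+1.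
  - by move=> xE; case: nx; exists m.+1.
move=> x /=; rewrite -t0 => /tI.
have [[n ->]|nx] := pselect (exists n, x = j n); rewrite ?tauj ?tauN //.
  by move=> /jI.
by move=> xE; apply: nx; exists 0%N.
Qed.

(** An injection of [K] into ['I_n + B] can be freed of one point of ['I_n] at a time, by
    precomposing it with a self-injection of [K], until it lands in [B]. The coding [r] lets the
    same lemma serve for sets of parameters and for index types. *)
Lemma small_adjoin_finite (K U W : Type) (B : set U) (C : set W) (n : nat)
    (r : W -> 'I_n + U) :
  small K [set: nat] -> small K B -> injective r ->
  (forall w u, C w -> r w = inr u -> B u) -> small K C.
Proof.
move=> Knat KB rI rB; apply: contrapT => /not_smallP[f fI fC].
suff main (m : nat) (h : K -> 'I_m + U) :
    injective h -> (forall x u, h x = inr u -> B u) -> False.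
  apply: (main n (r \o f)) => [|x u]; first exact: inj_comp.
  by move=> /= /rB; apply.
clear f fI fC rB rI r.
(* [K] does not embed in [nat], so it is infinite and contains a sequence. *)
have [j jI] : exists j : nat -> K, injective j.
  have : infinite_set [set: K].
    by move=> /finite_set_countable; apply/negP.
  move=> /infiniteP natK.
  have : ~ small nat [set: K] by rewrite /small => /negP; rewrite natK.
  by move=> /not_smallP[j jI _]; exists j.
elim: m => [|m IH] in h * => hI hB.
  have hE x : exists u, h x = inr u.
    by case: (h x) => [[]//|u]; exists u.
  have [h' h'E] := choice hE.
  apply/not_smallP: KB; exists h' => [x y xy|x]; last exact: (hB x).
  by apply: hI; rewrite !h'E xy.
have [s sI sN] : exists2 s : K -> K, injective s & forall x, h (s x) <> inl ord0.
  have [[x0 x0E]|nx0] := pselect (exists x, h x = inl ord0).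
    have [s sI sx] := infinite_type_avoid x0 jI.
    exists s => // x hx; apply: (sx x); apply: hI; congruence.
  by exists id => // x hx; apply: nx0; exists x.
have hE x : exists y : 'I_m + U,
    h (s x) = match y with inl i => inl (lift ord0 i) | inr u => inr u end.
  move: (sN x); case: (h (s x)) => [i|u _]; last by exists (inr u).
  by case: (unliftP ord0 i) => [i' ->|-> //]; exists (inl i').
have [h' h'E] := choice hE.
apply: (IH h').
  by move=> x y xy; apply/sI/hI; rewrite !h'E xy.
by move=> x u xu; apply: (hB (s x)); rewrite h'E xu.
Qed.

(** * Change of variables *)

(** Proof irrelevance turns the equation between the indices into [erefl], for an arbitrary index
    type. *)
Lemma existT_inj (I : Type) (P : I -> Type) (i : I) (x y : P i) :
  existT P i x = existT P i y -> x = y.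
Proof.
move=> xy; have := projT2_eq xy.
by rewrite (Prop_irrelevance (projT1_eq xy) erefl).
Qed.

Section ChangeOfVariables.
Variables (L : language) (M : structure L).

(** An entry packed with its sort: entries of tuples in different contexts can then be compared even
    if their sorts are equal only propositionally. *)
Definition elt_of (V : Type) (sg : V -> lsort L) (a : tup M sg) (v : V) :
  elt M := existT _ (sg v) (a v).

Lemma term_rename (V W : Type) (sg : V -> lsort L) (tg : W -> lsort L)
    (f : V -> W) (s : lsort L) (t : term sg s) :
  (forall v, tg (f v) = sg v) ->
  exists u : term tg s, forall (a : tup M sg) (b : tup M tg),
    (forall v, elt_of a v = elt_of b (f v)) -> eval b u = eval a t.
Proof.
move=> fs; elim: t => [v|g t IH].
  have [u uE] : exists u : term tg (sg v), forall (x : M (sg v)) (b : tup M tg),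
      existT _ _ x = elt_of b (f v) -> eval b u = x.
    move: (sg v) (fs v) => s' e; case: s' / e.
    by exists (Tvar tg (f v)) => x b xE; rewrite (existT_inj xE).
  by exists u => a b ab; apply: uE; exact: (ab v).
pose u i := sval (cid (IH i)).
exists (Tapp (f := g) u) => a b ab /=; congr fint.
by apply: functional_extensionality_dep => i; exact: (svalP (cid (IH i))).
Qed.

(** Stated by existence, together with the semantics, so that no cast along the sort equations [fs]
    appears later. At a quantifier the renaming becomes [omap f], which fixes the bound variable. *)
Lemma formula_rename (V W : Type) (sg : V -> lsort L) (tg : W -> lsort L)
    (f : V -> W) (phi : formula sg) :
  (forall v, tg (f v) = sg v) ->
  exists psi : formula tg, forall (a : tup M sg) (b : tup M tg),
    (forall v, elt_of a v = elt_of b (f v)) -> sat psi b <-> sat phi a.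
Proof.
elim: phi W tg f => {V sg} [V sg|V sg s t u|V sg r t|V sg phi IH|
    V sg phi IH1 psi IH2|V sg s phi IH] W tg f fs.
- by exists (Ffalse tg).
- have [t' tE] := term_rename t fs; have [u' uE] := term_rename u fs.
  by exists (Feq t' u') => a b ab /=; rewrite (tE a) // (uE a).
- pose t' i := sval (cid (term_rename (t i) fs)).
  exists (Frel (r := r) t') => a b ab /=.
  suff -> : (fun i => eval b (t' i)) = (fun i => eval a (t i)) by [].
  apply: functional_extensionality_dep => i.
  exact: (svalP (cid (term_rename (t i) fs))).
- have [psi psiE] := IH _ _ _ fs.
  by exists (Fnot psi) => a b ab /=; rewrite (psiE a b ab).
- have [phi' phiE] := IH1 _ _ _ fs; have [psi' psiE] := IH2 _ _ _ fs.
  by exists (Fand phi' psi') => a b ab /=; rewrite (phiE a b ab) (psiE a b ab).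
- have fs' v : ctx_cons tg s (omap f v) = ctx_cons sg s v by case: v => //= v.
  have [psi psiE] := IH _ _ _ fs'.
  exists (Fex psi) => a b ab /=.
  have E c : sat psi (tup_cons b c) <-> sat phi (tup_cons a c).
    by apply: psiE => -[v|//]; exact: ab.
  by split=> -[c /E]; exists c.
Qed.

(** * Definable sets *)

Definition definable_over (B : set (elt M)) (V : Type) (sg : V -> lsort L)
    (X : set (tup M sg)) : Prop :=
  exists phi : formula_over B sg, forall a, X a <-> sat_over phi a.

Lemma definable_overC B V (sg : V -> lsort L) (X : set (tup M sg)) :
  definable_over B X -> definable_over B (~` X).
Proof. by move=> [phi E]; exists (Fnot phi) => a; rewrite /= E. Qed.

Lemma definable_overI B V (sg : V -> lsort L) (X Y : set (tup M sg)) :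
  definable_over B X -> definable_over B Y -> definable_over B (X `&` Y).
Proof.
by move=> [phi E] [psi F]; exists (Fand phi psi) => a; rewrite /setI /= E F.
Qed.

Lemma definable_overT B V (sg : V -> lsort L) :
  definable_over B [set: tup M sg].
Proof. by exists (Fnot (Ffalse _)) => a /=; split=> // _ []. Qed.

Lemma definable_over_ext B V (sg : V -> lsort L) (X Y : set (tup M sg)) :
  (forall a, X a <-> Y a) -> definable_over B X -> definable_over B Y.
Proof. by move=> XY [phi E]; exists phi => a; rewrite -XY. Qed.

Lemma definable_overU B V (sg : V -> lsort L) (X Y : set (tup M sg)) :
  definable_over B X -> definable_over B Y -> definable_over B (X `|` Y).
Proof.
move=> /definable_overC X' /definable_overC Y'.
have := definable_overC (definable_overI X' Y').
apply: definable_over_ext => a; rewrite /setC /setI /setU /=.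
by split=> [/not_andP[] /contrapT|[] ? []]; [left | right | |].
Qed.

(** Every coordinate of [h b] is a coordinate of [b] or a constant in [C]. Parameters are variables
    of the enlarged context, so composing with [h] is a mere renaming of variables. *)
Lemma definable_over_preimage (B C : set (elt M)) (V W : Type)
    (sg : V -> lsort L) (tg : W -> lsort L) (h : tup M tg -> tup M sg)
    (X : set (tup M sg)) :
  B `<=` C ->
  (forall v, (exists w, forall b, elt_of (h b) v = elt_of b w) \/
             (exists2 e, C e & forall b, elt_of (h b) v = e)) ->
  definable_over B X -> definable_over C (h @^-1` X).
Proof.
move=> BC hP [phi phiE].
(* Some tuple is needed to read the sort equations off the equations between packed entries;
   carriers are inhabited. *)
have [b0 _] : exists b : tup M tg, True.
  have inh s : exists x : M s, True by case: (carrier_inhabited M s) => x; exists x.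
  by exists (fun w => sval (cid (inh (tg w)))).
have hP' v : exists u : W + {e | C e}, forall b,
    elt_of (h b) v = elt_of (tup_over (B := C) b) u.
  case: (hP v) => [[w wE]|[e Ce eE]]; first by exists (inl w).
  by exists (inr (exist _ e Ce)) => b; rewrite eE; case: (e) Ce.
have [f fE] := choice hP'.
pose f' (u : V + {e | B e}) : W + {e | C e} := match u with
  | inl v => f v
  | inr e => inr (exist _ (proj1_sig e) (BC _ (proj2_sig e)))
  end.
have f'E b u : elt_of (tup_over (B := B) (h b)) u = elt_of (tup_over b) (f' u).
  case: u => [v|e] /=; last by [].
  exact: fE.
have fs u : ctx_over tg (f' u) = ctx_over sg u.
  exact: esym (congr1 (@projT1 _ _) (f'E b0 u)).
have [psi psiE] := formula_rename phi fs.
by exists psi => b; rewrite /preimage /= phiE; apply: iff_sym; apply: psiE.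
Qed.

Lemma sub_definable_over (B C : set (elt M)) V (sg : V -> lsort L)
    (X : set (tup M sg)) :
  B `<=` C -> definable_over B X -> definable_over C X.
Proof.
move=> BC; apply: (definable_over_preimage (h := id)) => // v.
by left; exists v.
Qed.

End ChangeOfVariables.

(** * Automorphisms *)

Section Automorphisms.
Variables (L : language) (M : structure L).

Definition aut_tup (g : forall s, M s -> M s) (V : Type) (sg : V -> lsort L)
    (a : tup M sg) : tup M sg := fun v => g _ (a v).

Definition fixes (g : forall s, M s -> M s) (B : set (elt M)) : Prop :=
  forall e, B e -> g _ (projT2 e) = projT2 e.

Lemma fixesU g B C : fixes g (B `|` C) -> fixes g B /\ fixes g C.
Proof. by move=> gBC; split=> e eB; apply: gBC; [left | right]. Qed.

Lemma fixes_entries g V (sg : V -> lsort L) (a : tup M sg) :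
  fixes g (entries a) -> aut_tup g a = a.
Proof.
move=> ga; apply: functional_extensionality_dep => v.
by apply: (ga (elt_of a v)); exists v.
Qed.

Lemma eval_aut g V (sg : V -> lsort L) (a : tup M sg) s (t : term sg s) :
  is_automorphism g -> eval (aut_tup g a) t = g _ (eval a t).
Proof.
move=> gA; elim: t => //= f t IH; rewrite (aut_func gA); congr fint.
exact: functional_extensionality_dep.
Qed.

Lemma sat_aut g V (sg : V -> lsort L) (phi : formula sg) (a : tup M sg) :
  is_automorphism g -> sat phi (aut_tup g a) <-> sat phi a.
Proof.
move=> gA; elim: phi a => {V sg} [V sg|V sg s t u|V sg r t|V sg phi IH|
    V sg phi IH1 psi IH2|V sg s phi IH] a //=.
- rewrite !eval_aut //; split=> [|->//].
  exact: (bij_inj (aut_bij gA s)).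
- rewrite [X in _ <-> X](aut_rel gA).
  suff -> : (fun i => eval (aut_tup g a) (t i)) = (fun i => g _ (eval a (t i)))
    by [].
  by apply: functional_extensionality_dep => i; rewrite eval_aut.
- by rewrite IH.
- by rewrite IH1 IH2.
- have E c : aut_tup g (tup_cons a c) = tup_cons (aut_tup g a) (g s c).
    by apply: functional_extensionality_dep => -[].
  split=> -[c]; last by move=> ac; exists (g s c); rewrite -E IH.
  have [g' _ gK] := aut_bij gA s.
  by rewrite -[c]gK -E IH => ac; exists (g' c).
Qed.

Lemma definable_over_aut B V (sg : V -> lsort L) (X : set (tup M sg)) g a :
  is_automorphism g -> fixes g B -> definable_over B X ->
  X (aut_tup g a) <-> X a.
Proof.
move=> gA gB [phi phiE]; rewrite !phiE /sat_over -(sat_aut phi (tup_over a) gA).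
suff -> : tup_over (aut_tup g a) = aut_tup g (tup_over (B := B) a) by [].
apply: functional_extensionality_dep => -[v|[e eB]] //=.
by rewrite /aut_tup /= gB.
Qed.

Lemma aut_tup_surj g V (sg : V -> lsort L) (b : tup M sg) :
  is_automorphism g -> exists a, aut_tup g a = b.
Proof.
move=> gA.
have aP v : exists c, g _ c = b v.
  by have [h _ gK] := aut_bij gA (sg v); exists (h (b v)).
exists (fun v => sval (cid (aP v))).
by apply: functional_extensionality_dep => v; exact: svalP (cid (aP v)).
Qed.

End Automorphisms.
Arguments aut_tup {L M} g {V sg} a.

(** * Consequences of saturation and homogeneity *)

Section Monster.
Variables (L : language) (T : theory L) (M : structure L) (K : Type).
Hypothesis M_monster : monster_model T M K.

Lemma small_nat : small K [set: nat].
Proof.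
case: M_monster => K0 _ _ _; apply: contrapT => /not_smallP[f fI _].
by apply/not_smallP: K0; exists (fun x => inl (f x)) => // x y [] /fI.
Qed.

(** Only finitely many elements are added: an entry of [a] is coded by an index where it occurs, any
    other element by itself. *)
Lemma small_entries (B : set (elt M)) k (sg : 'I_k -> lsort L) (a : tup M sg) :
  small K B -> small K (B `|` entries a).
Proof.
move=> KB.
have rP (e : elt M) : exists u : 'I_k + elt M,
    (forall i, u = inl i -> e = elt_of a i) /\
    (forall e', u = inr e' -> e = e' /\ ((B `|` entries a) e -> B e)).
  have [[i _ <-]|ne] := pselect (entries a e).
    by exists (inl i); split=> // j [<-].
  by exists (inr e); split=> // e' [<-]; split=> // -[].
have [r rE] := choice rP.
apply: (small_adjoin_finite (r := r) small_nat KB) => [e e' ee|e e' eC er].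
  case er: (r e) => [i|e1].
    by rewrite ((rE e).1 _ er) ((rE e').1 i) // -ee.
  by rewrite ((rE e).2 _ er).1; have [-> //] := (rE e').2 e1 (etrans (esym ee) er).
by have [<-] := (rE e).2 _ er; apply.
Qed.

(** Strong homogeneity is applied to [a] and [b], each followed by an enumeration of [B], so that
    the automorphism obtained fixes [B]. One inclusion between the types suffices, since formulas
    can be negated. *)
Lemma homogeneous_over (B : set (elt M)) k (sg : 'I_k -> lsort L)
    (a b : tup M sg) :
  small K B -> (forall X, definable_over B X -> X a -> X b) ->
  exists g, [/\ is_automorphism g, fixes g B & aut_tup g a = b].
Proof.
move=> KB ab; case: M_monster => _ _ _ hom.
have KI : small K [set: 'I_k + {e | B e}].
  have rI : injective (fun u : 'I_k + {e | B e} =>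
      match u with inl i => inl i | inr e => inr (proj1_sig e) end).
    move=> [i|[e eB]] [j|[e' eB']] //= []; first by move=> ->.
    by move=> ee'; congr inr; apply: eq_exist.
  apply: (small_adjoin_finite small_nat KB rI) => -[i|[e eB]] //= e' _ [<-] //.
have E : same_type (tup_over (B := B) a) (tup_over b).
  have imp phi : sat_over (B := B) phi a -> sat_over phi b.
    by apply: (ab (sat_over (B:=B) phi)); exists phi.
  move=> phi; split; first exact: imp.
  by move=> bphi; apply: contrapT => /(imp (Fnot phi)); exact.
have [g gA gE] := hom _ _ _ _ KI E; exists g; split=> // [e eB|].
  exact: (gE (inr (exist _ e eB))).
by apply: functional_extensionality_dep => i; exact: (gE (inl i)).
Qed.

(** * Compactness *)

(** That is, [R] is the intersection of the [B]-definable sets containing it, the set of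
    realizations of a partial type over [B]. *)
Definition type_definable_over (B : set (elt M)) V (sg : V -> lsort L)
    (R : set (tup M sg)) : Prop :=
  forall a, (forall X, definable_over B X -> R `<=` X -> X a) -> R a.

(* Compactness, applied to pairs of tuples: otherwise the type saying that
   x, y lie in R, agree on all of G, and disagree on X would be satisfiable. *)
Lemma finitely_many_determine (B : set (elt M)) (V : finType)
    (sg : V -> lsort L) (R X : set (tup M sg)) (G : set (set (tup M sg))) :
  small K B -> type_definable_over B R -> definable_over B X ->
  (forall Y, G Y -> definable_over B Y) ->
  (forall x y, R x -> R y -> (forall Y, G Y -> (Y x <-> Y y)) -> X x -> X y) ->
  exists2 l : seq (set (tup M sg)), (forall Y, Y \in l -> G Y) &
    forall x y, R x -> R y -> (forall Y, Y \in l -> (Y x <-> Y y)) -> X x -> X y.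
Proof.
move=> KB defR defX defG detX; apply: contrapT => no_l.
(* Saturation speaks of tuples indexed by an ordinal, so a pair of tuples is coded by one tuple over
   an enumeration of [V + V]. *)
pose VV : finType := (V + V)%type.
pose sg2 (v : VV) := match v with inl v => sg v | inr v => sg v end.
pose sgm (i : 'I_#|{: VV}|) := sg2 (enum_val i).
pose join (x y : tup M sg) : tup M sg2 :=
  fun v => match v with inl v => x v | inr v => y v end.
pose mk x y : tup M sgm := fun i => join x y (enum_val i).
have mkE x y v : elt_of (mk x y) (enum_rank v) = elt_of (join x y) v.
  by rewrite /elt_of /mk /sgm enum_rankK.
have sortE v : sgm (enum_rank v) = sg2 v by rewrite /sgm enum_rankK.
have projP (z : tup M sgm) (f : V -> VV) : (forall v, sg2 (f v) = sg v) ->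
    exists x : tup M sg, forall v, elt_of x v = elt_of z (enum_rank (f v)).
  move=> fE; have xP v : exists c : M (sg v),
      existT (fun s => M s) (sg v) c = elt_of z (enum_rank (f v)).
    by rewrite -(fE v) -(sortE (f v)); exists (z (enum_rank (f v))).
  by exists (fun v => sval (cid (xP v))) => v; rewrite /elt_of; case: (cid (xP v)).
have liftP Y (f : V -> VV) : (forall v, sg2 (f v) = sg v) -> definable_over B Y ->
    exists psi : formula_over B sgm, forall (x : tup M sg) z,
      (forall v, elt_of x v = elt_of z (enum_rank (f v))) ->
      (sat_over psi z <-> Y x).
  move=> fE [phi phiE].
  pose f' (u : V + {e | B e}) : 'I_#|{: VV}| + {e | B e} :=
    match u with inl v => inl (enum_rank (f v)) | inr e => inr e end.
  have f'E u : ctx_over sgm (f' u) = ctx_over sg u.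
    by case: u => [v|//] /=; rewrite sortE.
  have [psi psiE] := formula_rename M phi f'E.
  exists psi => x z xz; rewrite phiE; apply: psiE => -[v|//].
  exact: xz.
pose disagree (l : seq (set (tup M sg))) x y :=
  [/\ R x, R y, forall Y, Y \in l -> (Y x <-> Y y) & X x /\ ~ X y].
(* A formula enters [q] as soon as it holds at every pair in [R] that agrees on some finite part of
   [G] but is separated by [X]; by [no_l] such pairs exist for every finite part. *)
pose q : set (formula_over B sgm) := [set psi | exists2 l : seq (set (tup M sg)),
  (forall Y, Y \in l -> G Y) &
  forall x y, disagree l x y -> sat_over psi (mk x y)].
have q_fs : finitely_satisfiable q.
  move=> q0 /(@finite_seqP {classic formula_over B sgm})[s ->] sq.
  suff [l lG lP] : exists2 l : seq (set (tup M sg)), (forall Y, Y \in l -> G Y) &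
      forall x y, disagree l x y -> forall psi, psi \in s -> sat_over psi (mk x y).
    have [x [y dxy]] : exists x y, disagree l x y.
      apply: contrapT => nd; apply: no_l; exists l => // x y Rx Ry xy Xx.
      by apply: contrapT => nXy; apply: nd; exists x, y.
    by exists (mk x y) => psi /(lP _ _ dxy).
  elim: s sq => [|psi s IH] sq; first by exists [::].
  have [l lG lP] : exists2 l : seq (set (tup M sg)), (forall Y, Y \in l -> G Y) &
      forall x y, disagree l x y -> forall psi, psi \in s -> sat_over psi (mk x y).
    by apply: IH => chi chis; apply: sq; rewrite /= in_cons chis orbT.
  have [l' l'G l'P] := sq psi (mem_head _ _).
  exists (l ++ l') => [Y|x y [Rx Ry xy Xxy] chi].
    by rewrite mem_cat => /orP[/lG|/l'G].
  rewrite in_cons => /orP[/eqP ->|chis].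
    by apply: l'P; split=> // Y Yl; apply: xy; rewrite mem_cat Yl orbT.
  by apply: lP => //; split=> // Y Yl; apply: xy; rewrite mem_cat Yl.
case: M_monster => _ _ sat_M _.
have [z zq] := sat_M _ _ _ _ KB q_fs.
have [x xz] := projP z inl (fun=> erefl).
have [y yz] := projP z inr (fun=> erefl).
have liftl Y := liftP Y inl (fun=> erefl).
have liftr Y := liftP Y inr (fun=> erefl).
have nil_G (Y : set (tup M sg)) : Y \in [::] -> G Y by [].
have Rx : R x.
  apply: defR => Y defY RY; have [psi psiE] := liftl _ defY.
  apply/(psiE x z xz)/zq; exists [::] => // a b [Ra _ _ _].
  by apply/(psiE a) => [v|]; [rewrite mkE | exact: RY].
have Ry : R y.
  apply: defR => Y defY RY; have [psi psiE] := liftr _ defY.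
  apply/(psiE y z yz)/zq; exists [::] => // a b [_ Rb _ _].
  by apply/(psiE b) => [v|]; [rewrite mkE | exact: RY].
have xy Y : G Y -> Y x <-> Y y.
  have half Z : definable_over B Z -> (forall a b, (G Y -> (Y a <-> Y b)) ->
      G Y -> Z a -> Z b) -> G Y -> Z x -> Z y.
    move=> defZ Zab GY Zx; have [psi psiE] := liftl _ defZ.
    have [chi chiE] := liftr _ defZ; apply: contrapT => nZy.
    (* This formula says that [Z x] implies [Z y]; the list [[:: Y]] puts it into [q]. *)
    have : sat_over (Fnot (Fand psi (Fnot chi))) z.
      apply: zq; exists [:: Y] => [Y'|a b [_ _ ab _] [/= pa nb]].
        by rewrite inE => /eqP ->.
      apply: nb; apply/(chiE b) => [v|]; first by rewrite mkE.
      apply: (Zab a) => // [_|]; first by apply: ab; rewrite mem_head.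
      by apply/(psiE a (mk a b)) => // v; rewrite mkE.
    by apply; split; [apply/(psiE x) | move/(chiE y z yz)].
  move=> GY; split; first by apply: half => //; [exact: defG | move=> a b /[apply] ->].
  move=> Yy; apply: contrapT => nYx; apply: (half (~` Y)) Yy => //.
    exact/definable_overC/defG.
  by move=> a b /[apply] ab /=; rewrite /setC /= ab.
have Xx : X x.
  have [psi psiE] := liftl _ defX.
  apply/(psiE x z xz)/zq; exists [::] => // a b [_ _ _ [Xa _]].
  by apply/(psiE a) => [v|//]; rewrite mkE.
have : (~` X) y.
  have [psi psiE] := liftr _ (definable_overC defX).
  apply/(psiE y z yz)/zq; exists [::] => // a b [_ _ _ [_ Xb]].
  by apply/(psiE b) => [v|//]; rewrite mkE.
by apply; exact: detX Rx Ry xy Xx.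
Qed.

End Monster.

(** * Boolean combinations of finitely many sets *)

(** By induction on [l], for all [R]: the first set of [l] cuts [R] in two, and the solutions found
    on the two parts are glued. Once [l] is empty, [X] contains all of [R] or misses it, and the
    whole space and the empty set are made from [Y0]. *)
Lemma boolean_closure (U : Type) (Phi : set (set U)) (l : seq (set U))
    (R X : set U) :
  Phi !=set0 -> (forall Y, Phi Y -> Phi (~` Y)) ->
  (forall Y Z, Phi Y -> Phi Z -> Phi (Y `&` Z)) ->
  (forall Y, Y \in l -> Phi Y) ->
  (forall x y, R x -> R y -> (forall Y, Y \in l -> (Y x <-> Y y)) -> X x -> X y) ->
  exists2 Z, Phi Z & forall x, R x -> (Z x <-> X x).
Proof.
move=> [Y0 PY0] PC PI.
have PU Y Z : Phi Y -> Phi Z -> Phi (Y `|` Z).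
  by move=> /PC PY /PC PZ; have := PC _ (PI _ _ PY PZ); rewrite setCI !setCK.
elim: l R => [|Y l IH] R lP det.
  have [[x [Rx Xx]]|nX] := pselect (exists x, R x /\ X x).
    exists (Y0 `|` ~` Y0); first by apply: PU => //; exact: PC.
    by rewrite setUv => y Ry; split=> // _; exact: det Rx Ry _ Xx.
  exists (Y0 `&` ~` Y0); first by apply: PI => //; exact: PC.
  by rewrite setICr => y Ry; split=> // Xy; case: nX; exists y.
have PY : Phi Y by apply: lP; rewrite mem_head.
have lP' Z : Z \in l -> Phi Z by move=> Zl; apply: lP; rewrite in_cons Zl orbT.
have [Z1 PZ1 Z1E] : exists2 Z, Phi Z & forall x, (R `&` Y) x -> (Z x <-> X x).
  apply: IH => // x y [Rx Yx] [Ry Yy] xy; apply: det => // Z.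
  by rewrite in_cons => /orP[/eqP ->|]; [split | exact: xy].
have [Z0 PZ0 Z0E] : exists2 Z, Phi Z & forall x, (R `&` ~` Y) x -> (Z x <-> X x).
  apply: IH => // x y [Rx Yx] [Ry Yy] xy; apply: det => // Z.
  by rewrite in_cons => /orP[/eqP ->|]; [split | exact: xy].
exists ((Y `&` Z1) `|` (~` Y `&` Z0)).
  by apply: PU; apply: PI => //; exact: PC.
move=> x Rx; have [Yx|nYx] := pselect (Y x).
  by rewrite -Z1E //; split=> [[[]|[]]|] //; left.
by rewrite -Z0E //; split=> [[[]|[]]|] //; right.
Qed.

(** * Relatively definable sets *)

Definition pair_fun (U : Type) (x y : U) : 'I_2 -> U :=
  fun i => if i == ord0 then x else y.

Lemma pair_fun_eta (U : Type) (f : 'I_2 -> U) :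
  f = pair_fun (f ord0) (f ord_max).
Proof.
apply: funext => i; rewrite /pair_fun; case: (eqVneq i ord0) => [->//|i0].
by congr f; apply: val_inj; case: i i0 => -[|[]].
Qed.

Lemma forall_pair_fun (U : Type) (P : U -> Prop) x y :
  (forall i, P (pair_fun x y i)) <-> P x /\ P y.
Proof.
split=> [Pxy|[Px Py] i]; first by split; [exact: (Pxy ord0) | exact: (Pxy ord_max)].
by rewrite /pair_fun; case: ifP.
Qed.

Section Pair.
Variables (L : language) (M : structure L) (A : set (elt M)).
Variables (k : nat) (sg : 'I_k -> lsort L) (p : set (formula_over A sg)).
Local Notation tuple := (tup M sg).
Local Notation pC := (realizations p).
Local Notation tup2 x y := (tup_power (pair_fun x y)).
Local Notation A_definable R := (relatively_definable_over p A (set_power2 R)).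

Lemma relatively_defines_pair (B : set (elt M))
    (phi : formula_over B (@ctx_power L k sg 2)) (R : tuple -> tuple -> Prop) :
  relatively_defines p phi (set_power2 R) <->
  (forall x y, R x y <-> sat_over phi (tup2 x y) /\ (pC x /\ pC y)).
Proof.
split=> [phiR x y|phiR].
  have := congr1 (fun X => X (pair_fun x y)) phiR.
  by rewrite /set_power2 /= => ->; rewrite /setI /= forall_pair_fun.
apply/predeqP => f; rewrite (pair_fun_eta f) /setI /set_power2 /=.
by rewrite phiR forall_pair_fun.
Qed.

Lemma relatively_definable_pair (B : set (elt M)) (R : tuple -> tuple -> Prop) :
  relatively_definable_over p B (set_power2 R) <->
  exists2 Y, definable_over B Y &
    forall x y, R x y <-> Y (tup2 x y) /\ (pC x /\ pC y).
Proof.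
split=> [[phi /relatively_defines_pair phiR]|[Y [phi phiE] YR]].
  by exists (sat_over phi) => //; exists phi.
by exists phi; apply/relatively_defines_pair => x y; rewrite YR phiE.
Qed.

Lemma relatively_definable_single (B : set (elt M)) (X : set tuple) :
  relatively_definable_over p B (set_power1 X) <->
  exists2 Y, definable_over B Y & X = Y `&` pC.
Proof.
split=> [[phi phiX]|[Y defY ->]].
  exists ((fun x => tup_power (fun _ : 'I_1 => x)) @^-1` sat_over phi).
    apply: (definable_over_preimage (B := B)) => // [v|]; last by exists phi.
    by left; exists v.2.
  apply/predeqP => x; have := congr1 (fun Z => Z (fun=> x)) phiX.
  rewrite /set_power1 /= => ->; rewrite /setI /=.
  by split=> -[? px]; split=> //; exact: (px ord0).
have [phi phiE] : definable_over B
    ((fun t : tup M (@ctx_power L k sg 1) => (fun i => t (ord0, i)) : tuple) @^-1` Y).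
  by apply: (definable_over_preimage (B := B)) => // v; left; exists (ord0, v).
exists phi; apply/predeqP => f; rewrite /set_power1 /setI /= -phiE /preimage /=.
split=> -[Yf pf]; split=> // i.
by rewrite (ord1 i).
Qed.

Lemma relatively_definable_section (a : tuple) (R : tuple -> tuple -> Prop) :
  pC a -> A_definable R ->
  relatively_definable_over p (A `|` entries a) (set_power1 [set y | R a y]).
Proof.
move=> pa /relatively_definable_pair[Y defY YR].
apply/relatively_definable_single; exists ((fun y => tup2 a y) @^-1` Y).
  apply: (definable_over_preimage (B := A)) => // v.
  have [v0|v0] := eqVneq v.1 ord0.
    right; exists (elt_of a v.2); first by right; exists v.2.
    by move=> b; rewrite /elt_of /tup_power /pair_fun v0 eqxx.
  left; exists v.2 => b; rewrite /elt_of /tup_power /pair_fun.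
  by rewrite (negbTE v0).
by apply/predeqP => y; rewrite /= YR /setI /preimage /=; tauto.
Qed.

(** The parameters taken from [a] become variables of the first of two tuples, and the variables of
    the formula become those of the second. *)
Lemma section_of_relatively_definable (a : tuple) (S : set tuple) :
  pC a -> relatively_definable_over p (A `|` entries a) (set_power1 S) ->
  exists2 R, A_definable R & forall y, S y <-> R a y.
Proof.
move=> pa /relatively_definable_single[Y [phi phiE] ->].
have fP (u : 'I_k + {e | (A `|` entries a) e}) :
    exists u' : 'I_2 * 'I_k + {e | A e}, forall y,
      elt_of (tup_over (B := A `|` entries a) y) u =
      elt_of (tup_over (B := A) (tup2 a y)) u'.
  case: u => [i|[e [Ae|ae]]]; first by exists (inl (ord_max, i)).
    by exists (inr (exist _ e Ae)).
  by case: ae (ae) => i _ <- ae'; exists (inl (ord0, i)).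
have [f fE] := choice fP.
have fs u : ctx_over (@ctx_power L k sg 2) (f u) = ctx_over sg u.
  exact: esym (congr1 (@projT1 _ _) (fE u a)).
have [psi psiE] := formula_rename M phi fs.
exists (fun x y => sat_over (B := A) psi (tup2 x y) /\ (pC x /\ pC y)).
  by apply/relatively_definable_pair; exists (sat_over psi) => //; exists psi.
move=> y; rewrite /setI /= phiE.
have : sat_over psi (tup2 a y) <-> sat_over phi y by apply: psiE => u; exact: fE.
tauto.
Qed.

(** * Closure properties and invariance of relatively definable relations *)

Lemma eq_A_definable : A_definable (fun x y => x = y /\ (pC x /\ pC y)).
Proof.
apply/relatively_definable_pair.
exists [set t | forall i, t (ord0, i) = t (ord_max, i)].
  (* Equality of tuples is a conjunction of [k] equations, built along an enumeration of the
     indices. *)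
  suff : forall s : seq 'I_k, definable_over A
      [set t : tup M (@ctx_power L k sg 2) |
        forall i, i \in s -> t (ord0, i) = t (ord_max, i)].
    move=> /(_ (enum 'I_k)); apply: definable_over_ext => t /=.
    by split=> tE i; [apply: tE; rewrite mem_enum | rewrite tE].
  elim=> [|i s IH].
    by apply: definable_over_ext (definable_overT _ _) => t; split.
  have defi : definable_over A
      [set t : tup M (@ctx_power L k sg 2) | t (ord0, i) = t (ord_max, i)].
    by exists (Feq (s := sg i) (Tvar (@ctx_over L M A _ (@ctx_power L k sg 2))
      (inl (ord0, i))) (Tvar (@ctx_over L M A _ (@ctx_power L k sg 2))
      (inl (ord_max, i)))).
  apply: definable_over_ext (definable_overI defi IH) => t; rewrite /setI /=.
  split=> [[ti ts] j|tE].
    by rewrite in_cons => /orP[/eqP ->|/ts].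
  by split=> [|j js]; apply: tE; rewrite in_cons ?eqxx ?js ?orbT.
move=> x y; split=> -[xy pxy]; split=> //; first by rewrite xy.
by apply: functional_extensionality_dep; exact: xy.
Qed.

Lemma total_A_definable : A_definable (fun x y => pC x /\ pC y).
Proof.
apply/relatively_definable_pair; exists setT; first exact: definable_overT.
by move=> x y; split=> [|[]].
Qed.

Lemma A_definable_swap (R : tuple -> tuple -> Prop) :
  A_definable R -> A_definable (fun x y => R y x).
Proof.
move=> /relatively_definable_pair[Y defY YR]; apply/relatively_definable_pair.
pose h (t : tup M (@ctx_power L k sg 2)) : tup M (@ctx_power L k sg 2) :=
  fun v => t (rev_ord v.1, v.2).
exists (h @^-1` Y).
  apply: (definable_over_preimage (B := A)) defY => // v.
  by left; exists (rev_ord v.1, v.2).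
move=> x y; rewrite YR /preimage /=.
have -> : h (tup2 x y) = tup2 y x.
  apply: functional_extensionality_dep => -[i j]; rewrite /h /tup_power /=.
  by case: i => -[|[|//]] ?.
tauto.
Qed.

Lemma A_definableU (R S : tuple -> tuple -> Prop) :
  A_definable R -> A_definable S -> A_definable (fun x y => R x y \/ S x y).
Proof.
move=> /relatively_definable_pair[Y defY YR].
move=> /relatively_definable_pair[Z defZ ZS].
apply/relatively_definable_pair; exists (Y `|` Z); first exact: definable_overU.
by move=> x y; rewrite YR ZS /setU /=; tauto.
Qed.

Lemma A_definableC (R : tuple -> tuple -> Prop) :
  A_definable R -> A_definable (fun x y => ~ R x y /\ (pC x /\ pC y)).
Proof.
move=> /relatively_definable_pair[Y defY YR]; apply/relatively_definable_pair.
exists (~` Y); first exact: definable_overC.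
by move=> x y; rewrite YR /setC /=; tauto.
Qed.

Lemma pC_aut g x :
  is_automorphism g -> fixes g A -> pC (aut_tup g x) <-> pC x.
Proof.
move=> gA gfix.
have E phi : sat_over (B := A) phi (aut_tup g x) <-> sat_over phi x.
  by apply: (definable_over_aut (B := A)) => //; exists phi.
by split=> px phi /px /E.
Qed.

Lemma A_definable_aut (R : tuple -> tuple -> Prop) g x y :
  A_definable R -> is_automorphism g -> fixes g A -> pC x -> pC y ->
  R (aut_tup g x) (aut_tup g y) <-> R x y.
Proof.
move=> /relatively_definable_pair[Y defY YR] gA gfix px py; rewrite !YR.
have pgx := pC_aut x gA gfix; have pgy := pC_aut y gA gfix.
have -> : tup2 (aut_tup g x) (aut_tup g y) = aut_tup g (tup2 x y).
  apply: functional_extensionality_dep => v; rewrite /tup_power /aut_tup.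
  by rewrite /pair_fun; case: ifP.
have := definable_over_aut (tup2 x y) gA gfix defY; tauto.
Qed.

Lemma equality_in_Ep :
  definable_equivalences p (fun x y => x = y /\ (pC x /\ pC y)).
Proof.
split; last exact: eq_A_definable.
by split=> [//|x y _ _ [-> []]|x y z _ _ _ [-> _] []].
Qed.

Lemma total_in_Ep : definable_equivalences p (fun x y => pC x /\ pC y).
Proof. by split; [split | exact: total_A_definable]. Qed.

Lemma pC_type_definable (B : set (elt M)) : A `<=` B -> type_definable_over B pC.
Proof.
move=> AB x xP phi pphi; apply: xP; last by move=> y; exact.
by apply: (sub_definable_over AB); exists phi.
Qed.

Lemma pC2_type_definable :
  type_definable_over A [set t : tup M (@ctx_power L k sg 2) |
    pC (fun i => t (ord0, i)) /\ pC (fun i => t (ord_max, i))].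
Proof.
move=> t tP.
have half (j : 'I_2) phi : p phi -> j = ord0 \/ j = ord_max ->
    sat_over phi ((fun i => t (j, i)) : tuple).
  move=> pphi jE.
  apply: (tP ((fun t => (fun i => t (j, i)) : tuple) @^-1` sat_over phi)).
    apply: (definable_over_preimage (B := A)) => // [v|]; last by exists phi.
    by left; exists (j, v).
  by move=> u [u0 u1] /=; rewrite /preimage /=; case: jE => ->; [exact: u0 | exact: u1].
by split=> phi pphi; apply: half => //; [left | right].
Qed.

End Pair.

(** * Weakly o-minimal pairs *)

Section WeaklyOMinimal.
Variables (L : language) (T : theory L) (M : structure L) (K : Type).
Hypothesis M_monster : monster_model T M K.
Variables (A : set (elt M)) (A_small : small K A).
Variables (k : nat) (sg : 'I_k -> lsort L) (p : set (formula_over A sg)).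
Variable lt : tup M sg -> tup M sg -> Prop.
Hypothesis p_wom : weakly_o_minimal_pair p lt.
Local Notation tuple := (tup M sg).
Local Notation pC := (realizations p).
Local Notation tup2 x y := (tup_power (pair_fun x y)).
Local Notation A_definable R := (relatively_definable_over p A (set_power2 R)).
Local Notation Ep := (definable_equivalences p).

Lemma lt_A_definable : A_definable lt.
Proof. by case: p_wom. Qed.

Lemma le_A_definable : A_definable (le p lt).
Proof.
have -> : le p lt = fun x y => lt x y \/ (x = y /\ (pC x /\ pC y)).
  apply: funext => x; apply: funext => y; apply: propext.
  split=> [[px py [xy|xy]]|[xy|[xy [px py]]]]; [by left | by right | |].
    have /relatively_definable_pair[Y _ YR] := lt_A_definable.
    by have [_ [px py]] := (YR _ _).1 xy; split=> //; left.
  by split=> //; right.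
by apply: A_definableU lt_A_definable _; exact: eq_A_definable.
Qed.

(** [relatively_defines] is an equality of sets, so a relatively defined relation holds only between
    realizations of [p]. *)
Lemma lt_pC x y : lt x y -> pC x /\ pC y.
Proof.
have /relatively_definable_pair[Y _ YR] := lt_A_definable.
by move=> /YR[].
Qed.

Lemma lt_irr x : ~ lt x x.
Proof.
by move=> xx; have [px _] := lt_pC xx; case: p_wom => _ _ [irr _ _] _; apply: (irr x).
Qed.

Lemma lt_trans x y z : lt x y -> lt y z -> lt x z.
Proof.
move=> xy yz; have [px py] := lt_pC xy; have [_ pz] := lt_pC yz.
by case: p_wom => _ _ [_ tr _] _; apply: (tr x y z).
Qed.

Lemma lt_total x y : pC x -> pC y -> [\/ lt x y, x = y | lt y x].
Proof. by case: p_wom => _ _ [_ _ tot] _; exact: tot. Qed.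

Lemma lt_asym x y : lt x y -> ~ lt y x.
Proof. by move=> xy yx; apply: (@lt_irr x); exact: lt_trans yx. Qed.

Lemma le_total x y : pC x -> pC y -> le p lt x y \/ lt y x.
Proof.
move=> px py; case: (lt_total px py) => [xy|->|yx]; last by right.
  by left; split=> //; left.
by left; split=> //; right.
Qed.

Lemma le_lt_trans x y z : le p lt x y -> lt y z -> lt x z.
Proof. by move=> [_ _ [xy|->]] //; exact: lt_trans xy. Qed.

Lemma lt_le_trans x y z : lt x y -> le p lt y z -> lt x z.
Proof. by move=> xy [_ _ [yz|<-]] //; exact: lt_trans xy yz. Qed.

Lemma le_trans x y z : le p lt x y -> le p lt y z -> le p lt x z.
Proof.
move=> xy [py pz [yz|<-]] //; have [px _ _] := xy.
by split=> //; left; exact: le_lt_trans xy yz.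
Qed.

Lemma ltW x y : lt x y -> le p lt x y.
Proof. by move=> xy; have [px py] := lt_pC xy; split=> //; left. Qed.

Lemma le_not_lt x y : le p lt x y -> ~ lt y x.
Proof. by move=> xy yx; apply: (@lt_irr x); exact: le_lt_trans xy yx. Qed.

Lemma le_refl x : pC x -> le p lt x x.
Proof. by move=> px; split=> //; right. Qed.

(** As [p] is complete, its realizations satisfy the same formulas over [A], and homogeneity
    applies. *)
Lemma pC_homogeneous x y : pC x -> pC y ->
  exists g, [/\ is_automorphism g, fixes g A & aut_tup g x = y].
Proof.
move=> px py; apply: (homogeneous_over M_monster A_small) => X [phi phiE].
rewrite !phiE => xphi; case: p_wom => -[_ compl] _ _ _.
by have [/py//|/px] := compl phi.
Qed.

(** * Alternating sequences and convexity of classes *)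

Lemma finite_union_of_convex_pigeonhole (D : set tuple) (u : nat -> tuple) :
  finite_union_of_convex p lt D -> (forall n, D (u n)) ->
  exists F i j, [/\ convex p lt F, F `<=` D, i < j, F (u i) & F (u j)].
Proof.
move=> [m [F [Fconv ->]]] uD.
have fP n : exists i, F i (u n) by have [i _ ui] := uD n; exists i.
have [f fE] := choice fP.
have /injectivePn[i [j ij fij]] : ~~ injectiveb (fun i : 'I_m.+1 => f i).
  by apply/negP => /injectiveP/leq_card; rewrite !card_ord ltnn.
have FD n : F n `<=` \bigcup_i F i by move=> x Fx; exists n.
wlog ltij : i j ij fij / i < j.
  move=> W; have [lij|lji|eij] := ltngtP i j; first exact: (W i j).
    by apply: (W j i) => //; rewrite eq_sym.
  by move: ij; rewrite (ord_inj eij) eqxx.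
by exists (F (f i)), i, j; split=> //; rewrite ?fij.
Qed.

(** Two of the [b n] lie in one convex piece of [D], which then contains the [c n] in between. With
    [lt'] the reverse of [lt], decreasing sequences are covered too. *)
Lemma no_infinite_alternation (lt' : tuple -> tuple -> Prop)
    (D : set tuple) (b c : nat -> tuple) :
  (lt' = lt \/ lt' = fun x y => lt y x) -> finite_union_of_convex p lt D ->
  (forall n, [/\ D (b n), ~ D (c n), lt' (b n) (c n) & lt' (c n) (b n.+1)]) ->
  False.
Proof.
move=> lt'E Dfin bc.
have [|F [i [j [[FpC Fconv] FD ij Fi Fj]]]] :=
  finite_union_of_convex_pigeonhole (u := b) Dfin; first by move=> n; case: (bc n).
have lt'tr x y z : lt' x y -> lt' y z -> lt' x z.
  by case: lt'E => ->; [exact: lt_trans | move=> yx zy; exact: lt_trans yx].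
have bcij m : lt' (c i) (b (i + m).+1).
  elim: m => [|m IH]; rewrite ?addn0 ?addnS; first by case: (bc i).
  by case: (bc (i + m).+1) => _ _ b1 b2; exact: lt'tr (lt'tr _ _ _ IH b1) b2.
have := bcij (j - i.+1); rewrite -addSn subnKC // => cb.
case: (bc i) => _ nDc b1 _; apply: nDc; apply: FD.
by case: lt'E b1 cb => -> b1 cb; [apply: (Fconv (b i) _ (b j)) |
  apply: (Fconv (b j) _ (b i))] => //; case: (lt_pC b1).
Qed.

Lemma iter_aut_lt g x y n :
  is_automorphism g -> fixes g A -> lt x y ->
  lt (iter n (aut_tup g) x) (iter n (aut_tup g) y).
Proof.
move=> gA gfix xy; elim: n => //= n IH; have [px py] := lt_pC IH.
by apply/(A_definable_aut lt_A_definable).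
Qed.

Lemma section_finite_union x (R : tuple -> tuple -> Prop) :
  pC x -> A_definable R -> finite_union_of_convex p lt [set y | R x y].
Proof.
move=> px /(relatively_definable_section px) defR.
by case: p_wom => _ _ _; apply; exists (A `|` entries x).
Qed.

(* If x < y < z with E x z but not E x y, an automorphism taking x to z
   iterates to an infinite alternation of the class of x. *)
Lemma Ep_convex E x y z : Ep E -> E x z -> lt x y -> lt y z -> E x y.
Proof.
move=> EE xz xy yz; apply: contrapT => nxy.
have [[Erefl Esym Etrans] defE] := EE.
have [px py] := lt_pC xy; have [_ pz] := lt_pC yz.
have [g [gA gfix gx]] := pC_homogeneous px pz.
pose it (n : nat) (w : tuple) : tuple := iter n (aut_tup g) w.
have itp n w : pC w -> pC (it n w).
  by move=> pw; rewrite /it; elim: n => //= n; move=> ?; apply/pC_aut.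
have itE n v w : pC v -> pC w -> E (it n v) (it n w) <-> E v w.
  move=> pv pw; elim: n => // n; rewrite /it /=.
  by rewrite (A_definable_aut defE gA gfix (itp n v pv) (itp n w pw)).
(* The translates of [x < y < z] by the powers of [g] fit end to end, since [g] takes [x] to [z]. *)
have itS n : it n z = it n.+1 x by rewrite -gx /it -iterSr.
have Ex n : E x (it n x).
  elim: n => [|n IH]; first exact: Erefl.
  apply: (Etrans _ _ _ px (itp n x px) (itp n.+1 x px) IH).
  by rewrite -itS; apply/itE.
apply: (no_infinite_alternation (or_introl erefl) (section_finite_union px defE)
  (b := it^~ x) (c := it^~ y)) => n; split=> //=.
- move=> xny; apply: nxy; apply/(itE n) => //.
  by apply: (Etrans _ x) => //; try exact: itp; apply: Esym => //; exact: itp.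
- exact: iter_aut_lt.
- by have := iter_aut_lt n gA gfix yz; rewrite -/(it n y) -/(it n z) itS.
Qed.

(** * Separating points by semiintervals *)

Lemma aut_no_jump (D : set tuple) g b c :
  is_automorphism g -> fixes g A -> finite_union_of_convex p lt D ->
  (forall x, D (aut_tup g x) <-> D x) ->
  D b -> lt b c -> lt c (aut_tup g b) -> D c.
Proof.
move=> gA gfix Dfin Dg Db bc cb; apply: contrapT => nDc.
pose it (n : nat) (w : tuple) : tuple := iter n (aut_tup g) w.
have itD n w : D (it n w) <-> D w by elim: n => //= n IH; rewrite Dg.
apply: (no_infinite_alternation (or_introl erefl) Dfin
  (b := it^~ b) (c := it^~ c)) => n; split; rewrite ?itD //.
  exact: iter_aut_lt.
by have := iter_aut_lt n gA gfix cb; rewrite -iterSr.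
Qed.

(** Between [b] and [d], all of [D] belongs to the convex component of [b]. Without such a [d],
    every point above [b] outside [D] would have below it a point of [D], and below that another
    point above [b] outside [D]; iteration gives a decreasing alternation. *)
Lemma component_bounded (D : set tuple) b c :
  finite_union_of_convex p lt D -> D b -> ~ D c -> lt b c ->
  exists d, [/\ lt b d, ~ D d & forall x y,
    lt b x -> lt x y -> lt y d -> D y -> D x].
Proof.
move=> Dfin Db nDc bc; apply: contrapT => no_d.
pose P := {d | lt b d /\ ~ D d}.
have step (d : P) : exists ed : tuple * P,
    [/\ D ed.1, lt ed.1 (sval d) & lt (sval ed.2) ed.1].
  case: d => d [bd nDd] /=; apply: contrapT => no_ed; apply: no_d; exists d.
  split=> // x y bx xy yd Dy; apply: contrapT => nDx; apply: no_ed.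
  by exists (y, exist _ x (conj bx nDx)).
have [f fE] := choice step.
pose d0 : P := exist _ c (conj bc nDc).
pose d n := iter n (fun d => (f d).2) d0.
apply: (@no_infinite_alternation (fun x y => lt y x) D (fun n => (f (d n)).1)
  (fun n => sval (d n.+1))) => // [|n]; first by right.
have [D1 _ lt2] := fE (d n); have [_ lt1 _] := fE (d n.+1).
by split=> //; case: (svalP (d n.+1)).
Qed.

Lemma separating_equivalence (D : set tuple) a b c :
  simple_semiintervals p lt ->
  relatively_definable_over p (A `|` entries a) (set_power1 D) ->
  lt a b -> lt b c -> D b -> ~ D c ->
  exists2 E, Ep E & E a b /\ ~ E a c.
Proof.
move=> simple defD ab bc Db nDc.
have [pa pb] := lt_pC ab; have [_ pc] := lt_pC bc.
have Dfin : finite_union_of_convex p lt D.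
  by case: p_wom => _ _ _; apply; exists (A `|` entries a).
have [Y defY DE] := (relatively_definable_single p _ D).1 defD.
have [d [bd nDd dP]] := component_bounded Dfin Db nDc bc.
have [_ pd] := lt_pC bd.
(* The points from [a] on that are not beyond the convex component of [b] in [D], described without
   [d] to make invariance over [Aa] accessible. *)
pose S := [set z | le p lt a z /\
  (le p lt z b \/ (lt b z /\ D z /\ forall y, lt b y -> lt y z -> D y))].
pose B := A `|` entries a.
have KB : small K B by exact: (small_entries M_monster).
pose B' := B `|` entries b `|` entries d.
have KB' : small K B' by do 2 apply: (small_entries M_monster).
have S_inv x y : pC x -> pC y ->
    (forall Z, definable_over B Z -> (Z x <-> Z y)) -> S x -> S y.
  move=> px py xy [ax Sx].
  have [g [gA gfix gx]] : exists g,
      [/\ is_automorphism g, fixes g B & aut_tup g x = y].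
    by apply: (homogeneous_over M_monster KB) => Z defZ; have [] := xy Z defZ.
    have [gfixA /fixes_entries ga] := fixesU gfix; rewrite -gx in py *.
  have Dg z : D (aut_tup g z) <-> D z.
    rewrite DE /setI /=; have := definable_over_aut z gA gfix defY.
    have := pC_aut p z gA gfixA; tauto.
  have ltg u v : lt u v -> lt (aut_tup g u) (aut_tup g v).
    by move=> uv; have [pu pv] := lt_pC uv;
      apply/(A_definable_aut lt_A_definable).
  have leg u v : le p lt u v -> le p lt (aut_tup g u) (aut_tup g v).
    move=> uv; have [pu pv _] := uv.
    by apply/(A_definable_aut le_A_definable).
  have pgb : pC (aut_tup g b) by apply/pC_aut.
  (* All points of [(b, g b]] lie in [D], so [b] and [g b] have the same component when
     [b < g b]. *)
  have jump w : lt b w -> le p lt w (aut_tup g b) -> D w.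
    move=> bw [_ _ [wb|->]]; last exact/Dg.
    exact: (aut_no_jump gA gfixA Dfin Dg Db bw wb).
  split; first by rewrite -ga; exact: leg.
  have [|bgx] := le_total py pb; [by left | right; split=> //].
  case: Sx => [xb|[bx [Dx bxD]]].
    have gxb := leg _ _ xb; split=> [|w bw wx]; first exact: jump.
    by apply: jump => //; apply: ltW; exact: lt_le_trans wx gxb.
  split=> [|w bw wx]; first exact/Dg.
  have [_ pw] := lt_pC bw.
  have [wb|bw'] := le_total pw pgb; first exact: jump.
  have [w' w'E] := aut_tup_surj w gA.
  have pw' : pC w' by apply/(pC_aut p w' gA gfixA); rewrite w'E.
  rewrite -w'E in wx bw' *; apply/Dg; apply: bxD.
    exact/(A_definable_aut lt_A_definable gA gfixA pb pw').
  exact/(A_definable_aut lt_A_definable gA gfixA pw' px).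
(* With the extra parameters [b] and [d], [S] is the set of [z >= a] such that [z <= b], or [z < d]
   and [z] is in [D]. *)
have [Z defZ SZ] : exists2 Z, definable_over B' Z & S = Z `&` pC.
  have [Y1 defY1 Y1E] := (relatively_definable_single p _ _).1
    (relatively_definable_section pa le_A_definable).
  have [Y2 defY2 Y2E] := (relatively_definable_single p _ _).1
    (relatively_definable_section pb (A_definable_swap le_A_definable)).
  have [Y3 defY3 Y3E] := (relatively_definable_single p _ _).1
    (relatively_definable_section pd (A_definable_swap lt_A_definable)).
  exists (Y1 `&` (Y2 `|` (Y3 `&` Y))).
    apply: definable_overI.
      by apply: sub_definable_over defY1 => e; left; left.
    apply: definable_overU.
      by apply: sub_definable_over defY2 => e [Ae|be];
        left; [left; left | right].
    apply: definable_overI.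
      by apply: sub_definable_over defY3 => e [Ae|de];
        [left; left; left | right].
    by apply: sub_definable_over defY => e; left; left.
  apply/predeqP => z; have := congr1 (fun X => X z) Y1E.
  have := congr1 (fun X => X z) Y2E; have := congr1 (fun X => X z) Y3E.
  have := congr1 (fun X => X z) DE; rewrite /S /setI /setU /= => Dz ltz lez gez.
  have -> : (Y1 z /\ (Y2 z \/ Y3 z /\ Y z)) /\ pC z <->
      le p lt a z /\ (le p lt z b \/ lt z d /\ D z).
    by rewrite Dz ltz lez gez; tauto.
  split=> -[az Sz]; split=> //; case: Sz => [zb|]; try by left.
    move=> [bz [Dz' bzD]]; right; split=> //; have [_ pz] := lt_pC bz.
    case: (lt_total pz pd) => // [zd|dz]; first by rewrite -zd in nDd.
    by case: nDd; exact: bzD.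
  move=> [zd Dz']; have [pz _] := lt_pC zd.
  have [|bz] := le_total pz pb; [by left | right; split=> //].
  by split=> // w bw wz; exact: dP bw wz zd Dz'.
have ZS x : pC x -> Z x <-> S x by rewrite SZ /setI /=; tauto.
(* The extra parameters are removed: by [S_inv] the sets definable over [B] determine [S] within
   [p(C)], so by compactness finitely many of them do, and [S] is relatively defined by a Boolean
   combination of these. *)
have defS : relatively_definable_over p B (set_power1 S).
  have AB' : A `<=` B' by move=> e; left; left; left.
  have [W|x y px py xy|l lB lP] := finitely_many_determine
      (G := [set Y | definable_over B Y]) M_monster KB'
      (pC_type_definable (p:=p) AB') defZ.
  - by apply: sub_definable_over => e; left; left.
  - by rewrite !ZS //; apply: S_inv.
  have [W defW WE] := boolean_closure (ex_intro _ _ (definable_overT _ _))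
    (@definable_overC _ _ B _ sg) (@definable_overI _ _ B _ sg) lB lP.
  apply/relatively_definable_single; exists W => //.
  by apply/predeqP => x; rewrite SZ /setI /=; split=> -[Wx px]; split=> //;
    apply/(WE x px).
have SpC : S `<=` pC by move=> z [[]].
have Sa : S a by split; [exact: le_refl | left; exact: ltW].
(* [S] contains [b] but not [c], so the [E] that determines [S] has [b] but not [c] in the class of
   [a]. *)
have [|E EE SE] := simple S a.
  split=> //; last by split=> // x [].
  split=> // x y z [ax _] [az Sz] py xy yz; split.
    exact: ltW (le_lt_trans ax xy).
  have [|yb] := le_total py pb; [by left | right; split=> //].
  case: Sz => [zb|[bz [Dz bzD]]].
    by case: (lt_asym yb (lt_le_trans yz zb)).
  by split=> [|w bw wy]; apply: bzD => //; exact: lt_trans wy yz.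
exists E => //.
have Sb : S b by split; [exact: ltW | left; exact: le_refl].
have nSc : ~ S c.
  by move=> [_ [/le_not_lt//|[_ [Dc _]]]].
split; first by move: Sb; rewrite SE => -[].
move=> Eac; apply: nSc; rewrite SE; split=> //.
exact/ltW/(lt_trans ab bc).
Qed.

(** An automorphism moves [a'] to [a], so the two pairs may share their first point. If [R]
    distinguished their second points [b] and [c], the section of [R] at [a], or its complement when
    [c < b], would yield an [E] separating them. *)
Lemma increasing_pairs_agree (R : tuple -> tuple -> Prop) a b a' b' :
  simple_semiintervals p lt -> A_definable R -> lt a b -> lt a' b' ->
  (forall E, Ep E -> E a b <-> E a' b') -> R a b -> R a' b'.
Proof.
move=> simple defR ab ab' Eab Rab; apply: contrapT => nRab'.
have [pa pb] := lt_pC ab; have [pa' pb'] := lt_pC ab'.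
have [g [gA gfix ga]] := pC_homogeneous pa' pa.
have move_b (Q : tuple -> tuple -> Prop) :
    A_definable Q -> Q a (aut_tup g b') <-> Q a' b'.
  by move=> defQ; rewrite -ga (A_definable_aut defQ).
set c := aut_tup g b' in move_b.
have ac : lt a c by apply/(move_b _ lt_A_definable).
have nRac : ~ R a c by move=> /(move_b _ defR).
have Eac E : Ep E -> E a b <-> E a c.
  by move=> EE; rewrite (Eab _ EE) move_b //; case: EE.
have [_ pc] := lt_pC ac.
case: (lt_total pb pc) => [bc|bc|cb]; last 2 first.
- by rewrite -bc in nRac.
- have [|//|E EE [Eac' nEab]] := separating_equivalence simple
    (relatively_definable_section pa (A_definableC defR)) ac cb.
  + by [].
  + by case.
  by apply: nEab; apply/Eac.
have [//|//|E EE [Eab' nEac]] := separating_equivalence simple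
  (relatively_definable_section pa defR) ab bc.
by apply: nEac; apply/Eac.
Qed.

(** * The two implications *)

Lemma simple_boolean_combination (X : set ('I_2 -> tuple)) :
  simple_semiintervals p lt -> relatively_definable_over p A X ->
  exists2 phi, boolean_combination (order_equivalence_formulas p lt) phi &
    relatively_defines p phi X.
Proof.
move=> simple; have -> : X = set_power2 (fun x y => X (pair_fun x y)).
  by apply/predeqP => f; rewrite /set_power2 /= -pair_fun_eta.
move: (fun x y => X (pair_fun x y)) => {X} R defR.
have [Y defY YR] := (relatively_definable_pair p _ _).1 defR.
pose fst_tup (t : tup M (@ctx_power L k sg 2)) : tuple := fun i => t (ord0, i).
pose snd_tup (t : tup M (@ctx_power L k sg 2)) : tuple := fun i => t (ord_max, i).
have tup2_eta t : t = tup2 (fst_tup t) (snd_tup t).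
  apply: functional_extensionality_dep => -[i j].
  have := congr1 (fun f : 'I_2 -> tuple => f i j)
    (pair_fun_eta (fun i => (fun j => t (i, j)) : tuple)).
  by [].
pose generators := order_equivalence_formulas p lt.
pose G : set (set (tup M (@ctx_power L k sg 2))) :=
  [set Z | exists2 phi, generators phi & Z = sat_over phi].
(* Tuples agreeing on the generating formulas agree on any relation [Q] whose defining formulas are
   generators. *)
have GQ (Q : tuple -> tuple -> Prop) t t' : A_definable Q ->
    (forall phi, relatively_defines p phi (set_power2 Q) -> generators phi) ->
    (forall Z, G Z -> (Z t <-> Z t')) ->
    pC (fst_tup t) /\ pC (snd_tup t) -> pC (fst_tup t') /\ pC (snd_tup t') ->
    Q (fst_tup t) (snd_tup t) <-> Q (fst_tup t') (snd_tup t').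
  move=> [phi phiQ] genQ tt' pt pt'.
  have /relatively_defines_pair QE := phiQ; rewrite !QE -!tup2_eta.
  have : sat_over phi t <-> sat_over phi t'.
    by apply: (tt' (sat_over phi)); exists phi => //; exact: genQ.
  tauto.
have det t t' : pC (fst_tup t) /\ pC (snd_tup t) ->
    pC (fst_tup t') /\ pC (snd_tup t') ->
    (forall Z, G Z -> (Z t <-> Z t')) -> Y t -> Y t'.
  move=> pt pt' tt'.
  have leE := GQ _ t t' le_A_definable (fun phi H => Or31 _ _ H) tt' pt pt'.
  have geE := GQ _ t t' (A_definable_swap le_A_definable)
    (fun phi H => Or32 _ _ H) tt' pt pt'.
  have EE E (EpE : Ep E) := GQ E t t' EpE.2
    (fun phi H => Or33 _ _ (ex_intro2 _ _ E EpE H)) tt' pt pt'.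
  have RY u : pC (fst_tup u) /\ pC (snd_tup u) ->
      R (fst_tup u) (snd_tup u) <-> Y u.
    by rewrite YR -tup2_eta; tauto.
  rewrite -!RY //; move: (fst_tup t) (snd_tup t) (fst_tup t') (snd_tup t')
    pt pt' leE geE EE => a b a' b' [pa pb] [pa' pb'] leE geE EE.
  (* Agreement on [x <= y] and [y <= x] gives both pairs the same order type. On the diagonal
     homogeneity suffices; decreasing pairs are turned round, which the symmetry of each [E]
     allows. *)
  case: (lt_total pa pb) => [ab|ab|ba].
  - apply: increasing_pairs_agree => //.
    have [/geE/le_not_lt|//] := le_total pb' pa'; exact.
  - have [[_ _ [ab'|<-]] ba'] : le p lt a' b' /\ le p lt b' a'.
      by split; [apply/leE | apply/geE]; rewrite ab; exact: le_refl.
      by case: (le_not_lt ba').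
    rewrite -ab; have [g [gA gfix <-]] := pC_homogeneous pa pa'.
    by rewrite (A_definable_aut defR).
  - apply: (increasing_pairs_agree (R := fun x y => R y x)) => //.
    + exact: A_definable_swap.
    + have [/leE/le_not_lt|//] := le_total pa' pb'; exact.
    + move=> E EpE; have [[_ Es _] _] := EpE.
      have EC x y : pC x -> pC y -> E x y <-> E y x.
        by move=> px py; split; exact: Es.
      by rewrite EC // (EC b') //; exact: EE.
(* Compactness leaves a finite list [l] of generators that already determines [Y] on pairs from
   [p(C)]. *)
have [Z [phi _ ->]|t t' pt pt' tt'|l lG lP] := finitely_many_determine M_monster A_small
  (pC2_type_definable (p := p)) defY (G := G); first by exists phi.
  exact: (det t t' pt pt' tt').
pose Phi : set (set (tup M (@ctx_power L k sg 2))) :=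
  [set Z | exists2 phi, boolean_combination generators phi & Z = sat_over phi].
have [|Z [phi bc ->]|Z W [phi bc ->] [psi bc' ->]|Z /lG[phi gphi ->]|
    Z [phi bc ->] phiE] := boolean_closure (Phi := Phi) _ _ _ _ lP.
- have [phi phile] := le_A_definable; exists (sat_over phi), phi => //.
  by apply: BCgen; apply: Or31.
- by exists (Fnot phi) => //; exact: BCnot.
- by exists (Fand phi psi) => //; exact: BCand.
- by exists phi => //; exact: BCgen.
exists phi => //; apply/relatively_defines_pair => x y; rewrite YR.
have : pC x /\ pC y -> sat_over phi (tup2 x y) <-> Y (tup2 x y).
  by move=> pxy; exact: phiE.
tauto.
Qed.

(** * From Boolean combinations to simple semiintervals *)

(** Strictly above [a], the formulas for [x <= y] and [y <= x] are constant, and a formula for [E]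
    cuts out the set that [E] determines; only such sets enter the list. Negation exchanges the
    roles of [y] and [z]. *)
Lemma boolean_combination_determined (a : tuple) phi :
  pC a -> boolean_combination (order_equivalence_formulas p lt) phi ->
  exists2 l : seq (set tuple),
    (forall H, H \in l -> equivalence_determined p lt H a) &
    forall y z, lt a y -> lt a z -> (forall H, H \in l -> (H y <-> H z)) ->
      sat_over phi (tup2 a y) -> sat_over phi (tup2 a z).
Proof.
move=> pa; elim=> {phi} [phi gphi|phi _ [l lP IH]|phi psi _ [l lP IH] _ [l' l'P IH']].
- case: gphi => [/relatively_defines_pair phiE|/relatively_defines_pair phiE|].
  + exists [::] => // y z ay az _ _; have [_ pz] := lt_pC az.
    by apply: (proj1 ((phiE a z).1 _)); exact: ltW.
  + exists [::] => // y z ay az _ phiy; case: (le_not_lt (x := y) (y := a)) => //.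
    by apply/phiE; have [_ py] := lt_pC ay.
  + move=> [E EE] /relatively_defines_pair phiE.
    exists [:: [set x | E a x /\ le p lt a x]] => [H|y z ay az yz phiy].
      by rewrite inE => /eqP ->; exists E.
    have [_ py] := lt_pC ay.
    have [yz1 _] := yz _ (mem_head _ _).
    have [|Eaz _] := yz1; first by split; [apply/phiE | exact: ltW].
    by case: ((phiE a z).1 Eaz).
- exists l => // y z ay az yz /= nphiy phiz; apply: nphiy; apply: IH phiz => //.
  by move=> H Hl; have [] := yz H Hl.
- exists (l ++ l') => [H|y z ay az yz [/= phiy psiy]].
    by rewrite mem_cat => /orP[/lP|/l'P].
  split; [apply: IH phiy | apply: IH' psiy] => // H Hl; apply: yz.
    by rewrite mem_cat Hl.
  by rewrite mem_cat Hl orbT.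
Qed.

Definition initial_from (a : tuple) (S : set tuple) : Prop :=
  (forall x, S x -> le p lt a x) /\
  forall x y, S x -> le p lt a y -> lt y x -> S y.

Lemma equivalence_determined_initial a S :
  pC a -> equivalence_determined p lt S a -> initial_from a S.
Proof.
move=> pa [E EE ->]; split=> [x []//|x y [Eax ax] ay yx]; split=> //.
case: ay => _ _ [ay|<-]; first exact: Ep_convex Eax ay yx.
by case: EE => -[Erefl _ _] _; exact: Erefl.
Qed.

(* b is taken above a point of S \ H for each H in l inside S, c below
   a point of H \ S for each H in l containing S. *)
Lemma initial_segments_not_separating a S (l : seq (set tuple)) b0 c0 :
  initial_from a S -> (forall H, H \in l -> initial_from a H /\ H <> S) ->
  S b0 -> ~ S c0 -> le p lt a c0 ->
  exists b c, [/\ S b, le p lt b0 b, ~ S c, le p lt a c & le p lt c c0] /\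
    forall b' c', S b' -> ~ S c' -> le p lt a c' -> le p lt b b' ->
      le p lt c' c -> forall H, H \in l -> (H b' <-> H c').
Proof.
move=> [aS initS] + Sb0 nSc0 ac0.
have pS x : S x -> pC x by move=> /aS[].
have ltS x y : S x -> ~ S y -> le p lt a y -> lt x y.
  move=> Sx nSy ay; have [_ py _] := ay.
  have [[_ _ [yx|yx]]|//] := le_total py (pS _ Sx); last by rewrite yx in nSy.
  by case: nSy; exact: initS yx.
have pc0 : pC c0 by case: ac0.
elim: l => [|H l IH] lP.
  exists b0, c0; split=> //; split=> //; [exact/le_refl/pS | exact: le_refl].
have [|b [c [[Sb b0b nSc ac cc0] bcP]]] := IH.
  by move=> H' H'l; apply: lP; rewrite in_cons H'l orbT.
have [[aH initH] HS] := lP H (mem_head _ _).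
(* If [S] has a point [u] outside [H], then [H] ends before [u], and raising [b] to [u] or beyond
   puts [b'] and [c'] outside [H]. *)
have [[u [Su nHu]]|SH] := pselect (exists u, S u /\ ~ H u).
  have [w [Sw bw uw]] : exists w, [/\ S w, le p lt b w & le p lt u w].
    have [bu|ub] := le_total (pS _ Sb) (pS _ Su).
      by exists u; split=> //; exact/le_refl/pS.
    by exists b; split=> //; [exact/le_refl/pS | exact: ltW].
  exists w, c; split; first by split=> //; exact: le_trans bw.
  move=> b' c' Sb' nSc' ac' wb' cc' H'; rewrite in_cons => /orP[/eqP ->|]; last first.
    by apply: bcP => //; exact: le_trans wb'.
  have nH x : le p lt u x -> ~ H x.
    move=> ux Hx; apply: nHu; case: ux => _ _ [ux|->//].
    exact: initH Hx (aS _ Su) ux.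
  have ub' := le_trans uw wb'.
  split=> [/(nH _ ub')//|/nH[]]; apply: le_trans ub' _.
  exact/ltW/ltS.
(* Now [S] is properly contained in [H]; lowering [c] to a point [v] of [H] outside [S], or below
   it, puts [b'] and [c'] in [H]. *)
have [[v [Hv nSv]]|HS'] := pselect (exists v, H v /\ ~ S v); last first.
  case: HS; apply/predeqP => x; split=> [Hx|Sx]; apply: contrapT => nx.
    by apply: HS'; exists x.
  by apply: SH; exists x.
have av := aH _ Hv; have pv : pC v by case: av.
have pc : pC c by case: ac.
have [w [nSw aw wc wv]] :
    exists w, [/\ ~ S w, le p lt a w, le p lt w c & le p lt w v].
  have [vc|cv] := le_total pv pc.
    by exists v; split=> //; exact: le_refl.
  by exists c; split=> //; [exact: le_refl | exact: ltW].
exists b, w; split; first by split=> //; exact: le_trans wc _.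
move=> b' c' Sb' nSc' ac' bb' cw H'; rewrite in_cons => /orP[/eqP ->|]; last first.
  by apply: bcP => //; exact: le_trans wc.
have inH x : le p lt a x -> le p lt x v -> H x.
  by move=> ax [_ _ [xv|->//]]; exact: initH xv.
have c'v := le_trans cw wv.
split=> _; apply: inH => //; first exact: aS.
by apply: le_trans c'v; exact/ltW/ltS.
Qed.

Lemma boolean_combination_simple :
  (forall X : set ('I_2 -> tuple), relatively_definable_over p A X ->
    exists2 phi, boolean_combination (order_equivalence_formulas p lt) phi &
      relatively_defines p phi X) ->
  simple_semiintervals p lt.
Proof.
move=> bcX S a [[SpC convS] [Sa minS] defS].
have pa := SpC _ Sa; apply: contrapT => nS.
have [R defR RS] := section_of_relatively_definable pa defS.
have [phi bcphi /relatively_defines_pair phiR] := bcX _ defR.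
have [l lP lphi] := boolean_combination_determined pa bcphi.
have initS : initial_from a S.
  split=> // x y Sx [_ py [ay|<-]] yx //; exact: convS Sa Sx py ay yx.
(* Otherwise [S] is [{a}], which equality determines. *)
have [b0 Sb0 ab0] : exists2 b0, S b0 & lt a b0.
  apply: contrapT => nb0; apply: nS; exists (fun x y => x = y /\ (pC x /\ pC y)).
    exact: equality_in_Ep.
  apply/predeqP => x; split=> [Sx|[[<-]]//].
  have [_ px [ax|->]] := minS _ Sx; first by case: nb0; exists x.
  by split; [split | exact: le_refl].
(* Otherwise [S] is [[a, oo)], which the total relation determines. *)
have [c0 nSc0 ac0] : exists2 c0, ~ S c0 & le p lt a c0.
  apply: contrapT => nc0; apply: nS; exists (fun x y => pC x /\ pC y).
    exact: total_in_Ep.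
  apply/predeqP => x; split=> [Sx|[_ ax]].
    by have ax := minS _ Sx; have [_ px _] := ax.
  by apply: contrapT => nSx; apply: nc0; exists x.
have [H Hl|b [c [[Sb b0b nSc ac _] bcP]]] :=
  initial_segments_not_separating (l := l) initS _ Sb0 nSc0 ac0.
  split; first exact/equivalence_determined_initial/lP.
  by move=> HS; apply: nS; rewrite -HS; exact: lP.
have [pb pc] : pC b /\ pC c by split; [exact: SpC | case: ac].
have ac' : lt a c by case: ac => _ _ [//|ac]; rewrite -ac in nSc.
have [phib _] := (phiR a b).1 ((RS b).1 Sb).
(* No set of the list separates [b] from [c], so [phi] passes from [(a, b)] to [(a, c)] and forces
   [c] into [S]. *)
apply: (nSc); apply/RS/phiR; split=> //.
apply: (lphi b) phib => // [|H Hl]; first exact: lt_le_trans b0b.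
by apply: bcP => //; exact: le_refl.
Qed.

End WeaklyOMinimal.

Theorem proposition2p13 (L : language) (T : theory L)
    (T_complete : complete_theory T)
    (M : structure L) (K : Type) (M_monster : monster_model T M K)
    (A : set (elt M)) (A_small : small K A)
    (k : nat) (sg : 'I_k -> lsort L) (p : set (formula_over A sg))
    (lt : tup M sg -> tup M sg -> Prop)
    (p_wom : weakly_o_minimal_pair p lt) :
  simple_semiintervals p lt <->
  (forall X : set ('I_2 -> tup M sg),
     relatively_definable_over p A X ->
     exists2 phi : formula_over A (@ctx_power L k sg 2),
       boolean_combination (order_equivalence_formulas p lt) phi &
       relatively_defines p phi X).
Proof.
split=> [simple X|].
  exact: (simple_boolean_combination M_monster A_small p_wom).
exact: (boolean_combination_simple M_monster A_small p_wom).
Qed.
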